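(* Let $m=2$ and $d\ge4$. Then $C^{(2,d)}_{j,\ell(n+1,k)}=0$ for the following indices $j\ge0$ and $k$ (only values $k\geq 1$ are meant). (A) Suppose $0\le n\le d-2$. Then it vanishes for $j<2n+1$ and $1\le k\le n+2$. (A1) If in addition $n$ is even, it vanishes when - $j$ is even or $j>nd-1$, and $k=1,3,\dots,n-1$; - $j$ is odd or $j>(n-2)d+4$, and $k=2,4,\dots,n-2$; - $j$ is odd or $j>(n-2)d+6$, and $k=n$; - $j$ is even or $j>nd+1$, and $k=n+1$; - $j$ is odd or $j>nd+2$, and $k=n+2$. (A2) If in addition $n$ is odd, it vanishes when - $j$ is even or $j>1+(n-1)d$, and $k=1,3,\dots,n-2$; - $j$ is odd or $j>2+(n-1)d$, and $k=2,4,\dots,n-1$; - $j$ is even or $j>3+(n-1)d$, and $k=n$; - $j$ is odd or $j>4+(n-1)d$, and $k=n+1$; - $j$ is even or $j>(n+1)d-1$, and $k=n+2$. (B) Suppose $n\ge d-1$. If $\mathrm{mod}(n+1-d,2)=0$, it vanishes for $j<2d+d(n+1-d)$ and $1\le k\le d$; if $\mathrm{mod}(n+1-d,2)=1$, it vanishes for $j<2d-3+d(n+2-d)$ and $1\le k\le d$. (B1) Suppose $n\ge d-1$, $d$ is even and $\mathrm{mod}(n+1-d,2)=0$ (so $n$ is odd). It vanishes when - $j$ is odd or $j>2+(n-1)d$, and $k=1,3,\dots,d-3$; - $j$ is even or $j>1+(n-1)d$, and $k=2,4,\dots,d-4$; - $j$ is even or $j>3+(n-1)d$, and $k=d-2$;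 - $j$ is odd or $j>4+(n-1)d$, and $k=d-1$; - $j$ is even or $j>(n+1)d-1$, and $k=d$. (B2) Suppose $n\ge d-1$, $d$ is even and $\mathrm{mod}(n+1-d,2)=1$ (so $n$ is even). It vanishes when - $j$ is even or $j>nd-1$, and $k=1,3,\dots,d-3$; - $j$ is odd or $j>(n-2)d+4$, and $k=2,4,\dots,d-4$; - $j$ is odd or $j>(n-2)d+6$, and $k=d-2$; - $j$ is even or $j>nd+1$, and $k=d-1$; - $j$ is odd or $j>nd+2$, and $k=d$. (B3) Suppose $n\ge d-1$, $d$ is odd and $\mathrm{mod}(n+1-d,2)=0$ (so $n$ is even). It vanishes when - $j$ is odd or $j>(n-2)d+4$, and $k=1,3,\dots,d-4$; - $j$ is even or $j>nd-1$, and $k=2,4,\dots,d-3$; - $j$ is odd or $j>(n-2)d+6$, and $k=d-2$; - $j$ is even or $j>nd+1$, and $k=d-1$; - $j$ is odd or $j>nd+2$, and $k=d$. (B4) Suppose $n\ge d-1$, $d$ is odd and $\mathrm{mod}(n+1-d,2)=1$ (so $n$ is odd). It vanishes when - $j$ is even or $j>1+(n-1)d$, and $k=1,3,\dots,d-4$; - $j$ is odd or $j>2+(n-1)d$, and $k=2,4,\dots,d-3$; - $j$ is even or $j>3+(n-1)d$, and $k=d-2$; - $j$ is odd or $j>4+(n-1)d$, and $k=d-1$; - $j$ is even or $j>(n+1)d-1$, and $k=d$.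
   Context: Let $w$ be a non-negative weight function whose support is an interval $I=(a,b)$, $(a,\infty)$ or $(-\infty,\infty)$, with all moments finite, and $\phi$ a real polynomial of degree $d$ with $\phi>0$ on $I$ ($\phi$ may vanish at endpoints of $I$). Let $\gamma_{2,d}=\{(x,y):y^2=\phi(x),x\in I\}$; polynomials are considered in $\mathbb{R}[x,y]/\langle y^2-\phi(x)\rangle$ with inner product $$\langle f,g\rangle_{\gamma_{2,d},w}=\int_I\big[f(x,\sqrt{\phi(x)})g(x,\sqrt{\phi(x)})+f(x,-\sqrt{\phi(x)})g(x,-\sqrt{\phi(x)})\big]w(x)\,dx.$$ $p_n(\omega;x)$ is the degree-$n$ orthonormal polynomial with positive leading coefficient with respect to $\int fg\,\omega\,dx$. The orthonormal $P$-basis is $P^{(2,d)}_{n,0}=p_n(w;x)/\sqrt2$, $n\ge0$, and $P^{(2,d)}_{n,1}=y\,p_{n-1}(\phi w;x)/\sqrt2$, $n\ge1$. Orthonormal OPs $Y^{(2,d)}_{n,k}$, $n\ge0$, $1\le k\le\min\{n+1,d\}$, are constructed as follows (''orthogonalising $f$'' means subtracting from $f$ its orthogonal projection onto the span of all previously constructed OPs and dividing by the norm of the result). $Y^{(2,d)}_{0,1}=P^{(2,d)}_{0,0}$. For $0\le n\le d-2$: orthogonalise $xY^{(2,d)}_{n,k}$ to get $Y^{(2,d)}_{n+1,k}$, in the order $k=1,\dots,n+1$, then orthogonalise $yY^{(2,d)}_{n,n+1}$ to get $Y^{(2,d)}_{n+1,n+2}$. For $n\ge d-1$: orthogonalise $yY^{(2,d)}_{n,k}$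 to get $Y^{(2,d)}_{n+1,k}$, in the order $k=1,\dots,d$. (These are OPs of degree $n$ on $\gamma_{2,d}$: degree meaning the lowest total degree among representatives modulo $y^2-\phi(x)$.) $\ell(n,k)=\frac{n(n+1)}2+k-1$ for $0\le n\le d-1$, $1\le k\le n+1$, and $\ell(n,k)=dn-\frac{d(d-1)}2+k-1$ for $n\ge d$, $1\le k\le d$. The connection coefficients are $C^{(2,d)}_{0,\ell(n,k)}=\langle Y^{(2,d)}_{n,k},P^{(2,d)}_{0,0}\rangle_{\gamma_{2,d},w}$, and for $i\ge1$, $C^{(2,d)}_{2i-1,\ell(n,k)}=\langle Y^{(2,d)}_{n,k},P^{(2,d)}_{i,0}\rangle_{\gamma_{2,d},w}$, $C^{(2,d)}_{2i,\ell(n,k)}=\langle Y^{(2,d)}_{n,k},P^{(2,d)}_{i,1}\rangle_{\gamma_{2,d},w}$. Lists such as $k=1,3,\dots,q$ are empty when $q$ is smaller than the first term. *)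

(* Defs.v *)
From HB Require Import structures.
From mathcomp Require Import all_boot all_order all_algebra.
From mathcomp Require Import all_classical all_reals all_analysis.

Set Implicit Arguments.
Unset Strict Implicit.
Unset Printing Implicit Defensive.

Import Order.TTheory GRing.Theory Num.Theory.
Import numFieldNormedType.Exports.

Local Open Scope classical_set_scope.
Local Open Scope ring_scope.

Section Weights.
Variable R : realType.
Implicit Types (I : interval R) (w omega : R -> R).

Definition admissible_interval I : Prop :=
  [\/ exists a b, a < b /\ I = `]a, b[,
      exists a, I = `]a, +oo[
    | I = `]-oo, +oo[ ].

(* The support of the measure w(x) dx, a closed set: saying that w has support
   (a, b) means that this set is the closure of (a, b).  A measurable w that is
   positive on (a, b) and zero elsewhere is an instance. *)
Definition weight_support w : set R :=
  [set x | forall U : set R, open U -> U x ->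
     (0 < \int[@lebesgue_measure R]_(t in U) (w t)%:E)%E].

Definition is_weight I w : Prop :=
  [/\ measurable_fun [set: R] w,
      forall x, 0 <= w x,
      weight_support w = closure [set` I]
    & forall n : nat, (@lebesgue_measure R).-integrable [set` I]
        (fun x => (x ^+ n * w x)%:E)].

Definition orthonormal_polys I omega (p : nat -> {poly R}) : Prop :=
  (forall n, size (p n) = n.+1 /\ 0 < lead_coef (p n)) /\
  (forall m n, \int[@lebesgue_measure R]_(x in [set` I])
     ((p m).[x] * (p n).[x] * omega x) = (m == n)%:R).

End Weights.

Section Curve.
Variables (R : realType) (d : nat) (I : interval R) (w : R -> R).
Variable phi : {poly R}.

(* R[x,y]/<y^2 - phi(x)> as the quotient of R[x][y]: the outer variable 'X of
   {poly {poly R}} is y.  A polynomial p in x embeds as p%:A, and a real scalar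
   c acts as c%:P *: _.  As curve_poly is monic of size 3, {poly %/ curve_poly}
   is a genuine quotient by it (see cy_sqr). *)
Definition curve_poly : {poly {poly R}} := 'X^2 - phi%:P.
Local Notation curve_ring := {poly %/ curve_poly}.

Implicit Types f g e : curve_ring.

Definition cx : curve_ring := 'X%:A.
Definition cy : curve_ring := in_qpoly curve_poly 'X.

Lemma curve_poly_monic : curve_poly \is monic.
Proof. exact: monicXnsubC. Qed.

Lemma mk_monic_curve_poly : mk_monic curve_poly = curve_poly.
Proof. by rewrite /mk_monic size_XnsubC // curve_poly_monic. Qed.

Lemma cy_sqr : cy ^+ 2 = phi%:A.
Proof.
have h0 : in_qpoly curve_poly curve_poly = 0.
  apply/val_inj; rewrite /= mk_monic_curve_poly.
  exact: (Pdiv.RingMonic.rmodpp curve_poly_monic).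
rewrite -in_qpoly1 -in_qpolyZ alg_polyC /cy expr2 -in_qpolyM -expr2.
by rewrite -[in LHS](subrK phi%:P 'X^2) in_qpolyD h0 add0r.
Qed.

Definition ceval f (a b : R) : R := (\val f : {poly {poly R}}).[b%:P].[a].

Definition inner f g : R :=
  \int[@lebesgue_measure R]_(x in [set` I])
    ((ceval f x (Num.sqrt phi.[x]) * ceval g x (Num.sqrt phi.[x]) +
      ceval f x (- Num.sqrt phi.[x]) * ceval g x (- Num.sqrt phi.[x])) * w x).

(* pw n stands for p_n(w; x) and pv n for p_n(phi w; x). *)
Variables pw pv : nat -> {poly R}.

Definition P0 (n : nat) : curve_ring := (Num.sqrt 2)^-1%:P *: (pw n)%:A.
Definition P1 (n : nat) : curve_ring :=
  (Num.sqrt 2)^-1%:P *: (cy * (pv n.-1)%:A).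

(* The P-basis in the order P_{0,0}, P_{1,0}, P_{1,1}, P_{2,0}, P_{2,1}, ... *)
Definition Pbasis (j : nat) : curve_ring :=
  if j == 0%N then P0 0 else if odd j then P0 j.+1./2 else P1 j./2.

(* The members of prev are orthonormal, so the sum is the orthogonal projection
   of f onto their span. *)
Definition orthogonalise (prev : seq curve_ring) f : curve_ring :=
  let g := f - \sum_(e <- prev) (inner f e)%:P *: e in
  (Num.sqrt (inner g g))^-1%:P *: g.

Definition orthogonalise_all (prev fs : seq curve_ring) : seq curve_ring :=
  foldl (fun acc f => rcons acc (orthogonalise acc f)) prev fs.

Definition ell (n k : nat) : nat :=
  if (n <= d - 1)%N then (n * (n + 1) %/ 2 + (k - 1))%N
  else (d * n - d * (d - 1) %/ 2 + (k - 1))%N.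

(* All Y_{m,k} with m <= n, in the order of construction; Y_{m,k} is the entry
   at position ell m k. *)
Fixpoint Yupto (n : nat) : seq curve_ring :=
  if n is n'.+1 then
    let prev := Yupto n' in
    let Yn' k := nth 0 prev (ell n' k) in
    orthogonalise_all prev
      (if (n' <= d - 2)%N
       then rcons [seq cx * Yn' k | k <- iota 1 n'.+1] (cy * Yn' n'.+1)
       else [seq cy * Yn' k | k <- iota 1 d])
  else [:: P0 0].

Definition Y (n k : nat) : curve_ring := nth 0 (Yupto n) (ell n k).

(* conn_coef j n k is the connection coefficient C_{j, ell(n,k)}. *)
Definition conn_coef (j n k : nat) : R := inner (Y n k) (Pbasis j).

End Curve.

Definition vanishes (R : realType) (C : nat -> nat -> R) (J K : pred nat) : Prop :=
  forall j k : nat, J j -> (1 <= k)%N -> K k -> C j k = 0.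

(* Main.v *)
From HB Require Import structures.
Require Import Defs.
From mathcomp Require Import all_boot all_order all_algebra.
From mathcomp Require Import all_classical all_reals all_analysis.
From mathcomp Require Import zify ring.

Import Order.TTheory GRing.Theory Num.Theory.
Local Open Scope ring_scope.

(** Every element of the curve ring is p(x) + y q(x) for unique p and q, and the
    terms odd in y cancel in the inner product ([inner_coord]):
      <p1 + y q1, p2 + y q2> = 2 int p1 p2 w + 2 int q1 q2 phi w.
    Hence pure p-parts and pure q-parts are orthogonal.  The P-basis is pure:
    P_{i,0}, at j = 2i - 1 (or j = i = 0), has a p-part of degree i, and P_{i,1},
    at j = 2i, has a q-part of degree i - 1.  A connection coefficient then
    vanishes for one of three reasons: the parities of Y and P_j differ, P_j has
    a higher degree than Y, or P_j lies in the span of the OPs constructed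
    before Y.

    All three are read off from the monomials x^a y^b with a < d, ordered by
    total degree and, within a degree, by decreasing a.  In this order the
    monomial for Y_{n,k} is the one with a = min(n + 1, d) - k and b = n - a.
    Multiplication by x or by y, in the way the construction uses it, preserves
    the order, so that ([Yseq_filtration]) Y is a combination of the monomials
    up to its own, with the parity of its own in y, and conversely each monomial
    is a combination of the OPs up to its own.

    Since y^2 = phi, the monomial x^a y^b has x-degree a + floor(b/2) d in its p-
    or q-part.  The first half of [Yseq_filtration] bounds the degree of Y by the
    largest x-degree among the earlier monomials of the same parity, which is
    often larger than that of its own monomial ([x_degree_leq]).  The second half
    makes Y orthogonal to all monomials of smaller total degree.  Those contain
    an element of x-degree e for every e with (e mod d) + 2 floor(e/d) < n in the
    p-part, and the same with one more in total degree in the q-part, which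
    gives the vanishing for small j ([conn_coef_low]). *)

(** * Polynomials orthonormal for a functional *)

Section OrthonormalPolynomials.
Set Implicit Arguments.
Unset Strict Implicit.
Variables (R : realType) (L : {scalar {poly R}}) (p : nat -> {poly R}).
Hypothesis size_p : forall n, size (p n) = n.+1.
Hypothesis ortho_p : forall m n, L (p m * p n) = (m == n)%:R.

(** Eliminating leading terms works for every sequence with one polynomial in each
    degree; [low_degree_vanish] applies this to a second such sequence. *)
Lemma orthonormal_expansion n (f : {poly R}) : (size f <= n)%N ->
  exists c : nat -> R, f = \sum_(i < n) c i *: p i.
Proof.
elim: n f => [|n IHn] f hf.
  exists (fun=> 0); rewrite big_ord0; apply/eqP.
  by rewrite -size_poly_leq0.
have lp0 : lead_coef (p n) != 0.
  by rewrite lead_coef_eq0 -size_poly_gt0 size_p.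
pose a := f`_n / lead_coef (p n).
have [|c hc] := IHn (f - a *: p n).
  apply/leq_sizeP => j; rewrite leq_eqVlt => /predU1P[<-|ltnj].
    rewrite coefB coefZ /a.
    have -> : (p n)`_n = lead_coef (p n) by rewrite lead_coefE size_p.
    by rewrite divfK ?subrr.
  by rewrite coefB coefZ !nth_default ?size_p ?mulr0 ?subr0 // (leq_trans hf).
exists (fun i => if i == n then a else c i).
rewrite big_ord_recr /= eqxx -[LHS](subrK (a *: p n)) hc; congr (_ + _).
by apply: eq_bigr => i _; rewrite ltn_eqF.
Qed.

Lemma L_expansion n (c : nat -> R) j :
  L ((\sum_(i < n) c i *: p i) * p j) = if (j < n)%N then c j else 0.
Proof.
rewrite mulr_suml linear_sum /=.
under eq_bigr do rewrite -scalerAl linearZ /= ortho_p.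
case: ifP => [ltjn|/negbT]; last first.
  rewrite -leqNgt => lenj; rewrite big1 // => i _.
  by rewrite ltn_eqF ?mulr0 // (leq_trans _ lenj).
rewrite (bigD1 (Ordinal ltjn)) //= eqxx mulr1 big1 ?addr0 // => i.
by rewrite -val_eqE /= => /negbTE->; rewrite mulr0.
Qed.

Lemma orthonormal_low_degree j (f : {poly R}) : (size f <= j)%N -> L (f * p j) = 0.
Proof.
by case/orthonormal_expansion => c ->; rewrite L_expansion ltnn.
Qed.

Lemma L_sqr n (c : nat -> R) (f := \sum_(i < n) c i *: p i) :
  L (f * f) = \sum_(i < n) c i ^+ 2.
Proof.
rewrite {2}/f mulr_sumr linear_sum /=; apply: eq_bigr => i _.
by rewrite -scalerAr linearZ /= L_expansion ltn_ord expr2.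
Qed.

(** Definiteness of the form [L (f * g)]: by the expansion in [p], its diagonal
    values are sums of squares. *)
Lemma L_sqr_ge0 f : 0 <= L (f * f).
Proof.
have [c ->] := orthonormal_expansion (leqnn (size f)).
by rewrite L_sqr sumr_ge0 // => i _; apply: sqr_ge0.
Qed.

Lemma L_sqr_eq0 f : L (f * f) = 0 -> f = 0.
Proof.
have [c ->] := orthonormal_expansion (leqnn (size f)).
rewrite L_sqr => /eqP; rewrite psumr_eq0 => [|i _]; last exact: sqr_ge0.
move=> /allP c0; rewrite big1 // => i _.
have /implyP := c0 i (mem_index_enum _).
by rewrite sqrf_eq0 => /(_ isT)/eqP->; rewrite scale0r.
Qed.

End OrthonormalPolynomials.

(** * Coordinates on the curve *)

Section Coordinates.
Set Implicit Arguments.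
Unset Strict Implicit.
Variables (R : realType) (phi : {poly R}).
Local Notation curve_ring := {poly %/ curve_poly phi}.
Implicit Types f g : curve_ring.

(** The coefficient of y^i in the reduced representative, of degree at most 1 in
    y, of an element of the curve ring. *)
Definition coord_y f (i : nat) : {poly R} := (\val f : {poly {poly R}})`_i.

Let size_curve_poly : size (curve_poly phi) = 3%N.
Proof. by rewrite size_XnsubC. Qed.

Lemma size_val f : (size (\val f : {poly {poly R}}) <= 2)%N.
Proof.
rewrite -ltnS; apply: (leq_trans (size_mk_monic f)).
by rewrite mk_monic_curve_poly size_curve_poly.
Qed.

Lemma coord_yD i f g : coord_y (f + g) i = coord_y f i + coord_y g i.
Proof. by rewrite /coord_y coefD. Qed.

Lemma coord_yZ i a f : coord_y (a *: f) i = a * coord_y f i.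
Proof. by rewrite /coord_y coefZ. Qed.

Lemma coord_y0 i : coord_y 0 i = 0.
Proof. by rewrite -(scale0r 0) coord_yZ mul0r. Qed.

Lemma coord_y1 i : coord_y 1 i = (i == 0)%:R.
Proof. by rewrite /coord_y coefC; case: i. Qed.

Lemma coord_ycy i : coord_y (cy phi) i = (i == 1)%:R.
Proof.
have e : in_qpoly (curve_poly phi) 'X = 'X :> {poly {poly R}}.
  by rewrite in_qpoly_small // mk_monic_curve_poly size_curve_poly size_polyX.
by apply: etrans (congr1 (fun q : {poly {poly R}} => q`_i) e) _; rewrite coefX.
Qed.

Lemma curve_ext f g :
  coord_y f 0 = coord_y g 0 -> coord_y f 1 = coord_y g 1 -> f = g.
Proof.
move=> e0 e1; apply/val_inj/polyP => -[//|[//|i]].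
by rewrite !nth_default // (leq_trans (size_val _)).
Qed.

Lemma curve_decomp f : f = coord_y f 0 *: 1 + coord_y f 1 *: cy phi.
Proof.
by apply: curve_ext; rewrite coord_yD !coord_yZ coord_y1 coord_ycy /=;
   rewrite !(mulr0, mulr1, addr0, add0r).
Qed.

Lemma coord_y_cxM i f : coord_y (cx phi * f) i = 'X * coord_y f i.
Proof. by rewrite /cx mulr_algl coord_yZ. Qed.

Lemma coord_y_cyM i f :
  coord_y (cy phi * f) i = if i is 0 then phi * coord_y f 1
                           else if i is 1 then coord_y f 0 else 0.
Proof.
have -> : cy phi * f = coord_y f 0 *: cy phi + (phi * coord_y f 1) *: 1.
  rewrite {1}(curve_decomp f) mulrDr -!scalerAr mulr1 -expr2 cy_sqr.
  by rewrite scalerA (mulrC phi).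
rewrite coord_yD !coord_yZ coord_y1 coord_ycy.
by case: i => [|[|i]] /=; rewrite !(mulr0, mulr1, addr0, add0r).
Qed.

Lemma cevalE f a b : ceval f a b = (coord_y f 0).[a] + (coord_y f 1).[a] * b.
Proof.
rewrite /ceval (horner_coef_wide _ (size_val f)) !big_ord_recl big_ord0 /=.
by rewrite addr0 expr0 expr1 mulr1 hornerD hornerM hornerC.
Qed.

End Coordinates.

(** * The moment functional *)

Section MomentFunctional.
Set Implicit Arguments.
Unset Strict Implicit.
Variables (R : realType) (I : interval R) (w : R -> R).
Hypothesis moments_fin : forall n : nat,
  (@lebesgue_measure R).-integrable [set` I] (fun x => (x ^+ n * w x)%:E).

Lemma integrable_poly_weight (p : {poly R}) :
  (@lebesgue_measure R).-integrable [set` I] (EFin \o (fun x => p.[x] * w x)).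
Proof.
have -> : EFin \o (fun x => p.[x] * w x) =
    (fun x => \sum_(i < size p) ((p`_i)%:E * (x ^+ i * w x)%:E))%E.
  apply/funext => x /=; rewrite horner_coef mulr_suml -sumEFin.
  by apply: eq_bigr => i _; rewrite -EFinM mulrA.
apply: integrable_sum => [|i _]; first exact: measurable_itv.
by apply: integrableZl => //; apply: measurable_itv.
Qed.

Lemma moment_functional : exists L : {scalar {poly R}}, forall p,
  L p = \int[@lebesgue_measure R]_(x in [set` I]) (p.[x] * w x).
Proof.
pose L0 (p : {poly R}) := \int[@lebesgue_measure R]_(x in [set` I]) (p.[x] * w x).
have mI : measurable [set` I] by apply: measurable_itv.
have linL : linear_for *%R L0.
  move=> a p q; rewrite /L0 -RintegralZl //; last exact: integrable_poly_weight.
  rewrite -RintegralD //; last exact: integrable_poly_weight.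
    by apply: eq_Rintegral => x _; rewrite hornerD hornerZ mulrDl mulrA.
  have := integrable_poly_weight (a *: p); congr (integrable _ _ _).
  by apply/funext => x /=; rewrite hornerZ mulrA.
pose mL := GRing.isLinear.Build R {poly R} R *%R L0 linL.
pose L : {scalar {poly R}} := HB.pack L0 mL.
by exists L.
Qed.

Variables (phi : {poly R}) (L : {scalar {poly R}}).
Hypothesis phi_gt0 : forall x, x \in I -> 0 < phi.[x].
Hypothesis LE : forall p,
  L p = \int[@lebesgue_measure R]_(x in [set` I]) (p.[x] * w x).

(** The two branches of the curve contribute the values at y and at - y, so the
    cross terms cancel, and y^2 = phi in the term with both q-parts. *)
Lemma inner_coord (f g : {poly %/ curve_poly phi}) :
  inner I w f g = L (coord_y f 0 * coord_y g 0) *+ 2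
                + L (phi * (coord_y f 1 * coord_y g 1)) *+ 2.
Proof.
transitivity (L ((coord_y f 0 * coord_y g 0) *+ 2
                 + (phi * (coord_y f 1 * coord_y g 1)) *+ 2)); last first.
  by rewrite raddfD /= !raddfMn.
rewrite LE; apply: eq_Rintegral => x /set_mem xI.
rewrite !cevalE hornerD !hornerMn !hornerM.
have := sqr_sqrtr (ltW (phi_gt0 xI)).
by move: (Num.sqrt _) => s <-; ring.
Qed.

End MomentFunctional.

(** * Spans *)

Section Span.
Set Implicit Arguments.
Unset Strict Implicit.
Variables (R : realType) (phi : {poly R}).
Local Notation curve_ring := {poly %/ curve_poly phi}.
Implicit Types (f g : curve_ring) (A B S : curve_ring -> Prop).

Definition subspace S : Prop :=
  [/\ S 0, forall f g, S f -> S g -> S (f + g) & forall c f, S f -> S (c%:P *: f)].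

(** The smallest subspace is encoded as an intersection, so that membership is
    proved and used without ever naming coefficients. *)
Definition span A f : Prop :=
  forall S, subspace S -> (forall e, A e -> S e) -> S f.

Lemma span_subspace A : subspace (span A).
Proof.
split=> [S [] //|f g hf hg S sS AS|c f hf S sS AS]; case: (sS) => _ SD SZ.
  by apply: SD; [apply: hf | apply: hg].
by apply: SZ; apply: hf.
Qed.

Lemma span_mem A f : A f -> span A f.
Proof. by move=> Af S _; apply. Qed.

Lemma span_trans A B f : (forall e, A e -> span B e) -> span A f -> span B f.
Proof. by move=> AB; apply => //; apply: span_subspace. Qed.

Lemma span_mono A B f : (forall e, A e -> B e) -> span A f -> span B f.
Proof. by move=> AB; apply: span_trans => e /AB/span_mem. Qed.

Lemma span_mul A B s f :
  (forall e, A e -> span B (s * e)) -> span A f -> span B (s * f).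
Proof.
move=> AB Af; have [B0 BD BZ] := span_subspace B.
apply: (Af (fun g => span B (s * g))) => //; split; first by rewrite mulr0.
- by move=> g h sg sh; rewrite mulrDr; apply: BD.
- by move=> c g sg; rewrite -scalerAr; apply: BZ.
Qed.

Lemma subspaceB S f g : subspace S -> S f -> S g -> S (f - g).
Proof.
case=> _ SD SZ Sf Sg; apply: SD => //.
by have := SZ (-1) _ Sg; rewrite polyCN scaleN1r.
Qed.

Lemma subspace_sum S n (F : nat -> curve_ring) : subspace S ->
  (forall i, (i < n)%N -> S (F i)) -> S (\sum_(i < n) F i).
Proof. by case=> S0 SD _ SF; elim/big_ind: _ => // i _; apply: SF. Qed.

End Span.

(** * Gram-Schmidt orthogonalisation *)

Section GramSchmidt.
Set Implicit Arguments.
Unset Strict Implicit.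
Variables (R : realType) (I : interval R) (w : R -> R) (phi : {poly R}).
Local Notation curve_ring := {poly %/ curve_poly phi}.
Implicit Types f g : curve_ring.
Local Notation "<< f , g >>" := (inner I w f g).
Hypothesis innerC : forall f g, <<f, g>> = <<g, f>>.
Hypothesis innerDl : forall f g h, <<f + g, h>> = <<f, h>> + <<g, h>>.
Hypothesis innerZl : forall c f g, <<c%:P *: f, g>> = c * <<f, g>>.
Hypothesis inner_ge0 : forall f, 0 <= <<f, f>>.
Hypothesis inner_eq0 : forall f, <<f, f>> = 0 -> f = 0.

Let innerZr c f g : <<f, c%:P *: g>> = c * <<f, g>>.
Proof. by rewrite innerC innerZl innerC. Qed.

Lemma inner0l f : <<0, f>> = 0.
Proof. by rewrite -(scale0r 0) -[0](polyC0 R) innerZl mul0r. Qed.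

Let innerBl f g h : <<f - g, h>> = <<f, h>> - <<g, h>>.
Proof.
by rewrite innerDl -scaleN1r -[1]/(1%:P) -polyCN innerZl mulN1r.
Qed.

Let inner_suml n (F : 'I_n -> curve_ring) h :
  <<\sum_(i < n) F i, h>> = \sum_(i < n) <<F i, h>>.
Proof.
apply: (big_morph (fun f => <<f, h>>)) => [f g|]; last exact: inner0l.
exact: innerDl.
Qed.

Lemma inner_orthogonal_subspace f : subspace (fun g => <<f, g>> = 0).
Proof.
split=> [|g h eg eh|c g eg]; first by rewrite innerC inner0l.
- by rewrite innerC innerDl innerC eg innerC eh addr0.
- by rewrite innerZr eg mulr0.
Qed.

Variable y : nat -> curve_ring.
Hypothesis y_orthogonalised :
  forall l, exists f, y l = orthogonalise I w (mkseq y l) f.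

Definition residual l f := f - \sum_(i < l) <<f, y i>>%:P *: y i.

Lemma orthogonaliseE l f (g := residual l f) :
  orthogonalise I w (mkseq y l) f = (Num.sqrt <<g, g>>)^-1%:P *: g.
Proof.
suff e : \sum_(e <- mkseq y l) <<f, e>>%:P *: e = \sum_(i < l) <<f, y i>>%:P *: y i.
  by rewrite /orthogonalise e.
by rewrite -(big_mkord xpredT (fun i => <<f, y i>>%:P *: y i)) /index_iota subn0 big_map.
Qed.

(** A zero residual is normalised to 0.  Stating that each vector is its squared
    norm times itself covers unit vectors and 0 at once, and is what projecting
    needs; inputs that depend on earlier ones require no separate treatment. *)
Lemma normalise_unit_or_zero g (e := (Num.sqrt <<g, g>>)^-1%:P *: g) :
  <<e, e>>%:P *: e = e.
Proof.
have [g0|gn0] := eqVneq <<g, g>> 0.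
  by rewrite /e (inner_eq0 g0) !scaler0.
rewrite {1 2}/e innerZl innerZr mulrA -expr2 exprVn sqr_sqrtr //.
by rewrite mulVf // scale1r.
Qed.

Lemma normaliseK g :
  (Num.sqrt <<g, g>>)%:P *: ((Num.sqrt <<g, g>>)^-1%:P *: g) = g.
Proof.
have [g0|gn0] := eqVneq <<g, g>> 0.
  by rewrite (inner_eq0 g0) !scaler0.
rewrite scalerA -polyCM mulfV ?scale1r // sqrtr_eq0 -ltNge lt_def gn0.
exact: inner_ge0.
Qed.

Lemma y_unit_or_zero l : <<y l, y l>>%:P *: y l = y l.
Proof.
have [f ->] := y_orthogonalised l.
by rewrite orthogonaliseE normalise_unit_or_zero.
Qed.

Lemma y_orthogonal l i : (i < l)%N -> <<y l, y i>> = 0.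
Proof.
elim/ltn_ind: l i => l IHl i ltil; have [f ->] := y_orthogonalised l.
suff e : <<residual l f, y i>> = 0 by rewrite orthogonaliseE innerZl e mulr0.
rewrite /residual innerBl inner_suml.
rewrite (bigD1 (Ordinal ltil)) //= big1 => [|j]; last first.
  rewrite -val_eqE /= => neji; rewrite innerZl.
  have [ltji|ltij|eji] := ltngtP j i; last by rewrite eji eqxx in neji.
    by rewrite (innerC (y j)) IHl // mulr0.
  by rewrite IHl // mulr0.
by rewrite addr0 innerZl -{1}[y i]y_unit_or_zero innerZr mulrC subrr.
Qed.

Definition y_upto l f : Prop := span (fun e => exists2 i, (i <= l)%N & e = y i) f.

Lemma input_in_span l f : y l = orthogonalise I w (mkseq y l) f -> y_upto l f.
Proof.
rewrite orthogonaliseE => yl.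
have [_ SD SZ] := span_subspace (fun e => exists2 i, (i <= l)%N & e = y i).
rewrite /y_upto -[f](subrK (\sum_(i < l) <<f, y i>>%:P *: y i)).
apply: SD; last first.
  apply: (subspace_sum (F := fun i => <<f, y i>>%:P *: y i)) => [|i ltil].
    exact: span_subspace.
  by apply: SZ; apply: span_mem; exists i => //; apply: ltnW.
rewrite -/(residual l f) -(normaliseK (residual l f)) -yl.
by apply: SZ; apply: span_mem; exists l.
Qed.

Lemma orthogonal_to_upto l l' f : (l' < l)%N -> y_upto l' f -> <<y l, f>> = 0.
Proof.
move=> ltl'l fy; apply: (fy (fun g => <<y l, g>> = 0)) => [|e [i leil' ->]].
  exact: inner_orthogonal_subspace.
by apply: y_orthogonal; apply: leq_ltn_trans leil' ltl'l.
Qed.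

(** In the projection, the terms with a zero coefficient need not lie in [S];
    this is how parity passes from the inputs to the outputs. *)
Lemma output_in_subspace S l f : subspace S ->
  y l = orthogonalise I w (mkseq y l) f -> S f ->
  (forall i, (i < l)%N -> <<f, y i>> = 0 \/ S (y i)) -> S (y l).
Proof.
move=> sS; rewrite orthogonaliseE => -> Sf Sy; case: (sS) => S0 _ SZ; apply: (SZ).
apply: subspaceB => //.
apply: (subspace_sum (F := fun i => <<f, y i>>%:P *: y i)) => // i ltil.
by have [->|Syi] := Sy i ltil; [rewrite scale0r | apply: SZ].
Qed.

End GramSchmidt.

(** * Ordering the monomials *)

Section Indexing.
Set Implicit Arguments.
Unset Strict Implicit.
Variable d : nat.
Hypothesis d_ge2 : (2 <= d)%N.

Definition block (n : nat) : nat := minn n.+1 d.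

Definition start (n : nat) : nat := ell d n 1.

Lemma ellE n k : ell d n k = (start n + (k - 1))%N.
Proof. by rewrite /start /ell subnn !addn0; case: ifP. Qed.

Lemma startS n : start n.+1 = (start n + block n)%N.
Proof.
rewrite /start /ell /block subnn !addn0.
have [ltnd|] := ltnP n (d - 1).
  rewrite (ltnW ltnd) (_ : minn _ _ = n.+1); last by lia.
  by rewrite (_ : (n.+1 * (n.+1 + 1) = n * (n + 1) + n.+1 * 2)%N) ?divnMDr; nia.
rewrite leq_eqVlt => /predU1P[<-|ltdn].
  rewrite leqnn; set e := (d - 1)%N; have -> : d = e.+1 by lia.
  have := oddM e e.+1; rewrite /= andbN addn1.
  by move=> /negbT; rewrite -dvdn2 => /dvdnP[q eq]; nia.
rewrite leqNgt ltdn /= (_ : minn _ _ = d); last by lia.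
have : (d * (d - 1) %/ 2 <= d * n)%N by nia.
nia.
Qed.

Lemma start0 : start 0 = 0%N.
Proof. by rewrite /start /ell leq0n mul0n div0n. Qed.

Lemma start_mono m n : (m <= n)%N -> (start m <= start n)%N.
Proof.
move/subnK <-; elim: (n - m)%N => // i IHi.
by rewrite addSn startS (leq_trans IHi) ?leq_addr.
Qed.

(** The index, in the order of construction, of the OP that belongs to the
    monomial x^a y^b with a < d. *)
Definition pos (a b : nat) : nat := ell d (a + b) (block (a + b) - a).

Lemma pos00 : pos 0 0 = 0%N.
Proof. by rewrite /pos ellE start0 /block; lia. Qed.

Lemma pos_ltn_degree a b a' b' : (a < d)%N -> (a + b < a' + b')%N ->
  (pos a b < start (a' + b'))%N.
Proof.
move=> ltad ltn; apply: leq_trans (start_mono ltn).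
by rewrite startS /pos ellE /block; lia.
Qed.

Lemma start_leq_pos a b : (start (a + b) <= pos a b)%N.
Proof. by rewrite /pos ellE leq_addr. Qed.

Definition precedes (a b a' b' : nat) : bool :=
  (a + b < a' + b')%N || (a + b == a' + b')%N && (a' < a)%N.

Lemma pos_precedes a b a' b' : (a < d)%N -> (a' < d)%N ->
  precedes a b a' b' -> (pos a b < pos a' b')%N.
Proof.
move=> ltad lta'd /orP[ltn|/andP[/eqP en lta]].
  exact: leq_trans (pos_ltn_degree ltad ltn) (start_leq_pos _ _).
by rewrite /pos en !ellE /block; lia.
Qed.

Lemma ltn_pos a b a' b' : (a < d)%N -> (a' < d)%N ->
  (pos a b < pos a' b')%N = precedes a b a' b'.
Proof.
move=> ltad lta'd; apply/idP/idP => [|/pos_precedes]; last exact.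
apply: contraTT => npre; rewrite -leqNgt.
have [pre|npre'] := boolP (precedes a' b' a b).
  exact: ltnW (pos_precedes _ _ pre).
have [-> ->] // : a = a' /\ b = b'.
by rewrite /precedes in npre npre'; lia.
Qed.

(** The block of degree n occupies the indices from [start n] to
    [start n.+1 - 1], with a decreasing from [block n - 1] to 0. *)
Lemma pos_onto l : exists a b, (a < d)%N /\ l = pos a b.
Proof.
have [n /andP[len ltn]] : exists n, (start n <= l < start n.+1)%N.
  elim: l => [|l [n /andP[len ltn]]].
    by exists 0%N; rewrite startS start0 /block; lia.
  have [ltl|lel] := ltnP l.+1 (start n.+1); first by exists n; lia.
  exists n.+1; rewrite lel (startS n.+1); have -> : l.+1 = start n.+1 by lia.
  by rewrite /block; lia.
rewrite startS in ltn.
pose a := (block n - 1 - (l - start n))%N; exists a, (n - a)%N.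
have lean : (a <= n)%N by rewrite /a /block; lia.
rewrite /pos subnKC // ellE; split; rewrite /a /block; [lia|].
by rewrite /a /block in lean *; rewrite /block in ltn; lia.
Qed.

End Indexing.

(** * The sequence of orthogonal polynomials *)

Section Construction.
Set Implicit Arguments.
Unset Strict Implicit.
Variables (R : realType) (d : nat) (I : interval R) (w : R -> R).
Variables (phi : {poly R}) (pw : nat -> {poly R}).
Hypothesis d_ge2 : (2 <= d)%N.
Local Notation curve_ring := {poly %/ curve_poly phi}.
Local Notation Yupto := (Yupto d I w phi pw).
Local Notation orthogonalise := (@orthogonalise R I w phi).
Local Notation orthogonalise_all := (@orthogonalise_all R I w phi).
Implicit Types (f : curve_ring) (prev fs : seq curve_ring).

Lemma orthogonalise_all_rcons prev fs f (s := orthogonalise_all prev fs) :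
  orthogonalise_all prev (rcons fs f) = rcons s (orthogonalise s f).
Proof. by rewrite /Defs.orthogonalise_all foldl_rcons. Qed.

Lemma size_orthogonalise_all prev fs :
  size (orthogonalise_all prev fs) = (size prev + size fs)%N.
Proof.
elim/last_ind: fs => [|fs f IHfs]; first by rewrite addn0.
by rewrite orthogonalise_all_rcons !size_rcons IHfs addnS.
Qed.

Lemma nth_orthogonalise_all_prev prev fs l : (l < size prev)%N ->
  nth 0 (orthogonalise_all prev fs) l = nth 0 prev l.
Proof.
move=> ltl; elim/last_ind: fs => // fs f IHfs.
rewrite orthogonalise_all_rcons nth_rcons size_orthogonalise_all IHfs.
by rewrite (leq_trans ltl) ?leq_addr.
Qed.

Lemma nth_orthogonalise_all prev fs i (s := orthogonalise_all prev fs) :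
  (i < size fs)%N -> nth 0 s (size prev + i) =
    orthogonalise (take (size prev + i) s) (nth 0 fs i).
Proof.
rewrite /s {s}; elim/last_ind: fs => // fs f IHfs; rewrite size_rcons ltnS.
rewrite orthogonalise_all_rcons !nth_rcons size_orthogonalise_all.
rewrite leq_eqVlt => /predU1P[->|ltif].
  by rewrite !ltnn !eqxx -cats1 -size_orthogonalise_all take_size_cat.
rewrite ltif ltn_add2l ltif IHfs //.
by rewrite -cats1 takel_cat // size_orthogonalise_all leq_add2l ltnW.
Qed.

Lemma size_Yupto n : size (Yupto n) = start d n.+1.
Proof.
elim: n => [|n IHn]; first by rewrite startS // start0 /block /=; lia.
rewrite [Yupto _]/= size_orthogonalise_all IHn (startS _ n.+1) //; congr addn.
by rewrite /block; case: ifP => h; rewrite /= ?size_rcons size_map size_iota; lia.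
Qed.

Lemma size_Yupto_gt l : (l < size (Yupto l))%N.
Proof.
elim: l => [|l]; rewrite ?size_Yupto; first by rewrite startS // /block; lia.
by rewrite (startS _ l.+1) // /block; lia.
Qed.

(** [Yupto n] is a prefix of [Yupto n.+1], so all these lists are prefixes of one
    infinite sequence; entry l is already present in [Yupto l]. *)
Definition Yseq (l : nat) : curve_ring := nth 0 (Yupto l) l.

Lemma nth_Yupto n l : (l < size (Yupto n))%N -> nth 0 (Yupto n) l = Yseq l.
Proof.
have stable m i : (l < size (Yupto m))%N ->
    nth 0 (Yupto (i + m)) l = nth 0 (Yupto m) l.
  move=> ltl; elim: i => // i IHi; rewrite addSn [Yupto _]/=.
  rewrite nth_orthogonalise_all_prev // (leq_trans ltl) // !size_Yupto.
  by rewrite start_mono // ltnS leq_addl.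
move=> ltl; rewrite /Yseq.
by rewrite -(stable n l) // addnC -(stable l n) ?size_Yupto_gt.
Qed.

Lemma take_Yupto n l : (l <= size (Yupto n))%N -> take l (Yupto n) = mkseq Yseq l.
Proof.
move=> lel; apply: (@eq_from_nth _ 0) => [|i]; rewrite size_takel //.
  by rewrite size_mkseq.
by move=> ltil; rewrite nth_take // nth_mkseq // nth_Yupto // (leq_trans ltil).
Qed.

Lemma YE n k : (1 <= k <= block d n)%N -> Y d I w phi pw n k = Yseq (ell d n k).
Proof.
by move=> hk; rewrite /Y nth_Yupto // size_Yupto startS // ellE; lia.
Qed.

Lemma Yseq_pos00 : Yseq (pos d 0 0) = P0 phi pw 0.
Proof. by rewrite pos00. Qed.

Definition inputs (n : nat) : seq curve_ring :=
  if (n <= d - 2)%N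
  then rcons [seq cx phi * Yseq (ell d n k) | k <- iota 1 n.+1]
             (cy phi * Yseq (ell d n n.+1))
  else [seq cy phi * Yseq (ell d n k) | k <- iota 1 d].

Lemma Yupto_inputs n : Yupto n.+1 = orthogonalise_all (Yupto n) (inputs n).
Proof.
have nthY k : (k < block d n)%N ->
    nth 0 (Yupto n) (ell d n k.+1) = Yseq (ell d n k.+1).
  by move=> hk; rewrite nth_Yupto // size_Yupto startS // ellE; lia.
rewrite -[LHS]/(orthogonalise_all (Yupto n) (if (n <= d - 2)%N
  then rcons [seq cx phi * nth 0 (Yupto n) (ell d n k) | k <- iota 1 n.+1]
             (cy phi * nth 0 (Yupto n) (ell d n n.+1))
  else [seq cy phi * nth 0 (Yupto n) (ell d n k) | k <- iota 1 d])).
rewrite /inputs; case: ifP => hn; congr orthogonalise_all.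
  rewrite nthY; last by rewrite /block; lia.
  congr rcons; apply/eq_in_map => k; rewrite mem_iota => hk.
  by rewrite (_ : k = k.-1.+1); [rewrite nthY // /block; lia | lia].
apply/eq_in_map => k; rewrite mem_iota => hk.
by rewrite (_ : k = k.-1.+1); [rewrite nthY // /block; lia | lia].
Qed.

Lemma Yseq_block n i : (i < block d n.+1)%N ->
  Yseq (start d n.+1 + i) =
    orthogonalise (mkseq Yseq (start d n.+1 + i)) (nth 0 (inputs n) i).
Proof.
move=> hi; have hs : (start d n.+1 + i < size (Yupto n.+1))%N.
  by rewrite size_Yupto (startS _ n.+1) // ltn_add2l.
rewrite -(nth_Yupto hs) -(take_Yupto (ltnW hs)) Yupto_inputs -size_Yupto.
rewrite nth_orthogonalise_all // /inputs.
by move: hi; rewrite /block; case: ifP => hn;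
  rewrite ?size_rcons size_map size_iota; lia.
Qed.

Let nth_map_iota (F : nat -> curve_ring) m n i : (i < n)%N ->
  nth 0 [seq F k | k <- iota m n] i = F (m + i)%N.
Proof. by move=> ltin; rewrite (nth_map 0%N) ?size_iota // nth_iota. Qed.

Lemma Yseq_stepx a b : (a + b <= d - 2)%N ->
  Yseq (pos d a.+1 b) =
    orthogonalise (mkseq Yseq (pos d a.+1 b)) (cx phi * Yseq (pos d a b)).
Proof.
move=> hn; have e : pos d a.+1 b = (start d (a + b).+1 + b)%N.
  by rewrite /pos addSn ellE /block; lia.
rewrite e Yseq_block; last by rewrite /block; lia.
rewrite /inputs hn nth_rcons size_map size_iota ltnS leq_addl.
congr orthogonalise; rewrite nth_map_iota; last by rewrite ltnS leq_addl.
congr (_ * Yseq _).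
by rewrite /pos /block; congr ell; lia.
Qed.

Lemma Yseq_stepy a b : (a < d)%N -> (a == 0%N) || (d - 1 <= a + b)%N ->
  Yseq (pos d a b.+1) =
    orthogonalise (mkseq Yseq (pos d a b.+1)) (cy phi * Yseq (pos d a b)).
Proof.
move=> ltad hab; pose i := (block d (a + b.+1) - a - 1)%N.
have e : pos d a b.+1 = (start d (a + b).+1 + i)%N.
  by rewrite /pos addnS ellE /i /block; lia.
rewrite e Yseq_block; last by rewrite /i /block; lia.
rewrite /inputs; case: ifP => hn.
  have a0 : a = 0%N by lia.
  rewrite nth_rcons size_map size_iota.
  have -> : i = (a + b).+1 by rewrite /i /block; lia.
  rewrite ltnn eqxx; congr (orthogonalise _ (_ * Yseq _)).
  by rewrite /pos /block; congr ell; lia.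
have ltid : (i < d)%N by rewrite /i /block; lia.
congr orthogonalise; rewrite nth_map_iota //.
congr (_ * Yseq _).
by rewrite /pos; congr ell; rewrite /i /block; lia.
Qed.

End Construction.

(** * The inner product in coordinates *)

Section CurveInnerProduct.
Set Implicit Arguments.
Unset Strict Implicit.
Variables (R : realType) (I : interval R) (w : R -> R) (phi : {poly R}).
Variable L : {scalar {poly R}}.
Local Notation curve_ring := {poly %/ curve_poly phi}.
Local Notation "<< f , g >>" := (@inner R I w phi f g).
Implicit Types f g h : curve_ring.
Hypothesis innerE : forall f g,
  <<f, g>> = L (coord_y f 0 * coord_y g 0) *+ 2
           + L (phi * (coord_y f 1 * coord_y g 1)) *+ 2.
Hypothesis L_ge0 : forall p, 0 <= L (p * p).
Hypothesis L_eq0 : forall p, L (p * p) = 0 -> p = 0.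
Hypothesis Lphi_ge0 : forall p, 0 <= L (phi * (p * p)).
Hypothesis Lphi_eq0 : forall p, L (phi * (p * p)) = 0 -> p = 0.

Lemma innerC f g : <<f, g>> = <<g, f>>.
Proof.
by rewrite !innerE (mulrC (coord_y f 0)) (mulrC (coord_y f 1)).
Qed.

Lemma innerDl f g h : <<f + g, h>> = <<f, h>> + <<g, h>>.
Proof.
rewrite !innerE !coord_yD !mulrDl mulrDr !raddfD /= !mulrnDl.
by rewrite addrACA.
Qed.

Lemma innerZl c f g : <<c%:P *: f, g>> = c * <<f, g>>.
Proof.
rewrite !innerE !coord_yZ -!mulrA (mulrCA phi) !mul_polyC !linearZ /=.
by rewrite -!mulrnAr -mulrDr.
Qed.

Lemma inner_ge0 f : 0 <= <<f, f>>.
Proof. by rewrite innerE addr_ge0 ?mulrn_wge0. Qed.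

Lemma inner_eq0 f : <<f, f>> = 0 -> f = 0.
Proof.
rewrite innerE => /eqP.
rewrite paddr_eq0 ?mulrn_wge0 // !mulrn_eq0 /= => /andP[/eqP f0 /eqP f1].
by apply: curve_ext; rewrite coord_y0; [apply: L_eq0 | apply: Lphi_eq0].
Qed.

Lemma inner_parity (s : bool) f g :
  coord_y f (~~ s) = 0 -> coord_y g s = 0 -> <<f, g>> = 0.
Proof.
by case: s => /= f0 g0; rewrite innerE f0 g0;
  rewrite !(mul0r, mulr0) raddf0 mul0rn addr0.
Qed.

End CurveInnerProduct.

(** * Filtration by monomials *)

Section Filtration.
Set Implicit Arguments.
Unset Strict Implicit.
Variables (R : realType) (d : nat) (I : interval R) (w : R -> R).
Variables (phi : {poly R}) (pw : nat -> {poly R}).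
Local Notation curve_ring := {poly %/ curve_poly phi}.
Local Notation "<< f , g >>" := (@inner R I w phi f g).
Local Notation y := (Yseq d I w phi pw).
Hypothesis d_ge2 : (2 <= d)%N.
Hypothesis innerC : forall f g, <<f, g>> = <<g, f>>.
Hypothesis innerDl : forall f g h, <<f + g, h>> = <<f, h>> + <<g, h>>.
Hypothesis innerZl : forall c f g, <<c%:P *: f, g>> = c * <<f, g>>.
Hypothesis inner_ge0 : forall f, 0 <= <<f, f>>.
Hypothesis inner_eq0 : forall f, <<f, f>> = 0 -> f = 0.
Hypothesis inner_parity : forall (s : bool) f g,
  coord_y f (~~ s) = 0 -> coord_y g s = 0 -> <<f, g>> = 0.
Hypothesis size_pw0 : size (pw 0) = 1%N.
Hypothesis unit_P00 : <<P0 phi pw 0, P0 phi pw 0>> = 1.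
Implicit Types f g : curve_ring.

Definition mon (a b : nat) : curve_ring := cx phi ^+ a * cy phi ^+ b.

Lemma monM a b a' b' : mon a b * mon a' b' = mon (a + a') (b + b').
Proof. by rewrite /mon mulrACA -!exprD. Qed.

Lemma coord_y_mon a b : coord_y (mon a b) (odd b) = 'X^a * phi ^+ b./2 /\
  coord_y (mon a b) (~~ odd b) = 0.
Proof.
elim: a => [|a [IHa IHa0]]; last first.
  by rewrite /mon exprS -mulrA !coord_y_cxM IHa IHa0 mulr0 exprS mulrA.
rewrite /mon !expr0 !mul1r; elim: b => [|b [IHb IHb0]].
  by rewrite expr0 !coord_y1.
rewrite exprS !coord_y_cyM -[b.+1]addn1 halfD andbT addn0 oddD /= addbT.
case: (odd b) IHb IHb0 => /= -> ->; rewrite ?mulr0 //.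
by rewrite add1n exprS.
Qed.

(** The monomial that belongs to an OP is x or y times the one that belongs to
    the OP it is made from.  The last clause says that the same factor keeps the
    exponent of x below d for all earlier monomials: a factor x is used only in
    total degree at most d - 2. *)
Lemma predecessor a b : (a < d)%N -> (0 < a + b)%N ->
  exists da db a' b', [/\ a = (da + a')%N, b = (db + b')%N, (0 < da + db)%N,
    y (pos d a b) =
      orthogonalise I w (mkseq y (pos d a b)) (mon da db * y (pos d a' b'))
    & forall a2 b2, (a2 < d)%N -> precedes a2 b2 a' b' -> (da + a2 < d)%N].
Proof.
case: a => [|a] ltad gt0; last case: (leqP (a.+1 + b) (d - 1)) => hn.
- case: b gt0 => // b _; exists 0, 1, 0, b; split=> //.
  by rewrite {1}/mon mul1r expr1; apply: Yseq_stepy.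
- exists 1, 0, a, b; split=> // [|a2 b2 _]; last by rewrite /precedes; lia.
  by rewrite {1}/mon expr0 expr1 mulr1; apply: Yseq_stepx; lia.
- case: b gt0 hn => [|b] gt0 hn; first by lia.
  exists 0, 1, a.+1, b; split=> //.
  by rewrite {1}/mon mul1r expr1; apply: Yseq_stepy; lia.
Qed.

Lemma Yseq_orthogonalised l : exists f, y l = orthogonalise I w (mkseq y l) f.
Proof.
have [a [b [ltad ->]]] := pos_onto d_ge2 l.
have [|e0] := ltnP 0 (a + b).
  by case/(predecessor ltad) => da [db [a' [b' [_ _ _ -> _]]]]; eexists.
have [-> ->] : a = 0%N /\ b = 0%N by lia.
exists (P0 phi pw 0); rewrite Yseq_pos00 // pos00 //=.
by rewrite /orthogonalise big_nil subr0 unit_P00 sqrtr1 invr1 scale1r.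
Qed.

Definition mons_upto (s : bool) (l : nat) (e : curve_ring) : Prop :=
  exists a b, [/\ (a < d)%N, (pos d a b <= l)%N, odd b = s & e = mon a b].

Lemma mons_upto_mono s l l' e : (l <= l')%N -> mons_upto s l e -> mons_upto s l' e.
Proof.
move=> lell' [a [b [ltad le oddb ->]]]; exists a, b; split=> //.
exact: leq_trans lell'.
Qed.

Lemma mons_upto_pure s l f : span (mons_upto s l) f -> coord_y f (~~ s) = 0.
Proof.
move=> sf; apply: (sf (fun f => coord_y f (~~ s) = 0)) => [|_ [a [b [_ _ <- ->]]]].
  split=> [|g h eg eh|c g eg]; first exact: coord_y0.
    by rewrite coord_yD eg eh addr0.
  by rewrite coord_yZ eg mulr0.
by case: (coord_y_mon a b).
Qed.

(** Induction along the order.  Let Y come from s Y', with s = x or y.  Monomials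
    up to that of Y' times s are monomials up to that of Y, which gives the first
    part; the projection only subtracts earlier OPs of the same parity, the
    others being orthogonal to s Y'.  For the second part, the monomial of Y' is
    a combination of OPs up to Y'.  Multiplied by s, its term with Y' is an input
    of Gram-Schmidt, hence in the span of the OPs up to Y, and its other terms
    are combinations of earlier monomials, to which induction applies. *)
Lemma Yseq_filtration a b : (a < d)%N ->
  span (mons_upto (odd b) (pos d a b)) (y (pos d a b)) /\
  y_upto y (pos d a b) (mon a b).
Proof.
have [l] := ubnP (pos d a b); elim: l a b => // l IHl a b; rewrite ltnS => lel ltad.
have [gt0|e0] := ltnP 0 (a + b); last first.
  have [-> ->] : a = 0%N /\ b = 0%N by lia.
  have /size_poly1P[k k0 pw0E] : size (pw 0) == 1%N by rewrite size_pw0.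
  have e : y (pos d 0 0) = ((Num.sqrt 2)^-1 * k)%:P *: mon 0 0.
    by rewrite Yseq_pos00 // /P0 pw0E scalerA -polyCM /mon !expr0 mulr1.
  split.
    rewrite e; case: (span_subspace (mons_upto (odd 0) (pos d 0 0))) => _ _; apply.
    by apply: span_mem; exists 0%N, 0%N; split=> //; lia.
  have c0 : (Num.sqrt 2)^-1 * k != 0 :> R.
    by rewrite mulf_neq0 // invr_neq0 // sqrtr_eq0 -ltNge.
  rewrite -[mon 0 0]scale1r -[1]/(1%:P) -(mulVf c0) polyCM -scalerA -e.
  case: (span_subspace (fun e => exists2 i, (i <= pos d 0 0)%N & e = y i)) => _ _.
  by apply; apply: span_mem; exists (pos d 0 0).
have [da [db [a' [b' [ea eb dgt0 yE ltda]]]]] := predecessor ltad gt0.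
have lta'd : (a' < d)%N by lia.
have lt' : (pos d a' b' < pos d a b)%N.
  by apply: pos_precedes => //; rewrite /precedes; lia.
have [IHW IHS] := IHl a' b' (leq_trans lt' lel) lta'd.
have shift a2 b2 : (a2 < d)%N -> (pos d a2 b2 < pos d a' b')%N ->
    (da + a2 < d)%N /\ (pos d (da + a2) (db + b2) < pos d a b)%N.
  move=> lta2d; rewrite ltn_pos // => pre; have lt2 := ltda _ _ lta2d pre.
  by split=> //; apply: pos_precedes => //; move: pre; rewrite /precedes; lia.
have spanF : span (mons_upto (odd b) (pos d a b)) (mon da db * y (pos d a' b')).
  apply: span_mul IHW => _ [a2 [b2 [lta2d le2 odd2 ->]]].
  rewrite monM; apply: span_mem; exists (da + a2)%N, (db + b2)%N.
  have odd3 : odd (db + b2) = odd b by rewrite eb !oddD odd2.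
  move: le2; rewrite leq_eqVlt => /predU1P[e2|lt2].
    have [-> ->] : a2 = a' /\ b2 = b'.
      have := ltn_pos d_ge2 b2 b' lta2d lta'd.
      have := ltn_pos d_ge2 b' b2 lta'd lta2d.
      by rewrite e2 ltnn /precedes; lia.
    by rewrite -ea -eb; split.
  by have [lt3 /ltnW] := shift _ _ lta2d lt2.
split.
  apply: (output_in_subspace (span_subspace _) yE spanF) => i lti.
  have [ai [bi [ltaid ei]]] := pos_onto d_ge2 i; rewrite ei in lti *.
  have [IHWi _] := IHl ai bi (leq_trans lti lel) ltaid.
  have [eodd|nodd] := eqVneq (odd bi) (odd b).
    right; rewrite eodd in IHWi; apply: span_mono IHWi => e.
    exact: mons_upto_mono (ltnW lti).
  left; apply: (@inner_parity (odd b)); first exact: mons_upto_pure spanF.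
  rewrite -[odd b]negbK; have -> : ~~ odd b = odd bi.
    by move: nodd; case: (odd b); case: (odd bi).
  exact: mons_upto_pure IHWi.
rewrite ea eb -monM -ea -eb; apply: span_mul IHS => _ [i lei ->].
move: lei; rewrite leq_eqVlt => /predU1P[->|lti].
  exact: input_in_span yE.
have [ai [bi [ltaid ei]]] := pos_onto d_ge2 i; rewrite ei in lti *.
have [IHWi _] := IHl ai bi (leq_trans (ltn_trans lti lt') lel) ltaid.
apply: span_mul IHWi => _ [a2 [b2 [lta2d le2 _ ->]]]; rewrite monM.
have [lt3 lt] := shift _ _ lta2d (leq_ltn_trans le2 lti).
have [_] := IHl _ _ (leq_trans lt lel) lt3.
apply: span_mono => _ [m lem ->]; exists m => //.
exact: leq_trans lem (ltnW lt).
Qed.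

Lemma Yseq_orthogonal_lower_degree a b a2 b2 : (a < d)%N -> (a2 < d)%N ->
  (a2 + b2 < a + b)%N -> <<y (pos d a b), mon a2 b2>> = 0.
Proof.
move=> ltad lta2d lt; have [_ up] := Yseq_filtration b2 lta2d.
apply: (orthogonal_to_upto _ _ _ _ _ Yseq_orthogonalised) up => //.
by apply: pos_precedes; rewrite // /precedes lt.
Qed.

End Filtration.

(** * Degree bounds *)

Section DegreeBounds.
Variable d : nat.
Hypothesis d_ge3 : (3 <= d)%N.

(** The largest x-degree among the monomials up to x^a y^(N-a) of the same parity
    in y.  For a <= 2 it is attained by the monomial itself.  For larger a it is
    attained in total degree N - 1, by y^(N-1) if a is odd and by x y^(N-2) if a
    is even: trading x^2 for y^2 raises the x-degree by d - 2. *)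
Definition x_degree_bound (N a : nat) : nat :=
  (if a <= 2 then a + (N - a)./2 * d
   else if odd a then (N - 1)./2 * d else 1 + (N - 2)./2 * d)%N.

(** With a fixed parity, lowering b2 by 2t lets a2 grow by 2t within the same total
    degree, and costs t d in x-degree.  One extra unit is needed where the
    monomial has total degree N and the bound comes from degree N - 1, hence
    3 t <= d t. *)
Lemma x_degree_leq a b a2 b2 :
  odd b2 = odd b -> precedes a2 b2 a b || ((a2 == a) && (b2 == b)) ->
  (a2 + b2./2 * d <= x_degree_bound (a + b) a)%N.
Proof.
move=> eodd; rewrite /precedes /x_degree_bound => pre.
have slope u v : (u <= v)%N ->
    exists t, [/\ v = (u + t)%N, (v * d = u * d + t * d)%N & (t * 3 <= t * d)%N].
  move=> leuv; exists (v - u)%N.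
  by rewrite -mulnDl subnKC // leq_mul2l d_ge3 orbT.
case: ifP => ha.
  have -> : (a + b - a)%N = b by lia.
  have /slope[t [et -> le3]] : (b2./2 <= b./2)%N by lia.
  by move: (t * d)%N (b2./2 * d)%N le3 => X Y; lia.
case: ifP => oa.
  have /slope[t [et -> le3]] : (b2./2 <= (a + b - 1)./2)%N by lia.
  by move: (t * d)%N (b2./2 * d)%N le3 => X Y; lia.
have /slope[t [et -> le3]] : (b2./2 <= (a + b - 2)./2)%N by lia.
by move: (t * d)%N (b2./2 * d)%N le3 => X Y; lia.
Qed.

Lemma double_x_degree_bound N a : (x_degree_bound N a).*2 =
  (if a <= 2 then a.*2 + (N - a)./2.*2 * d
   else if odd a then (N - 1)./2.*2 * d else 2 + (N - 2)./2.*2 * d)%N.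
Proof.
rewrite /x_degree_bound; case: ifP => _; last case: ifP => _;
  by rewrite ?doubleD doubleMl.
Qed.

Lemma leq_divmod e q r : (r < d)%N -> (e <= q * d + r)%N ->
  (e %/ d < q)%N \/ (e %/ d = q)%N /\ (e %% d <= r)%N.
Proof.
move=> ltrd le; have [ltq|leq|eq] := ltngtP (e %/ d) q; first by left.
  suff: (e < (e %/ d) * d)%N by have := divn_eq e d; lia.
  by rewrite (leq_ltn_trans le) // (leq_trans _ (leq_mul leq (leqnn d))) // mulSn; lia.
by right; split=> //; move: le; rewrite {1}(divn_eq e d) eq leq_add2l.
Qed.

End DegreeBounds.

(** * Connection coefficients *)

Section ConnectionCoefficients.
Set Implicit Arguments.
Unset Strict Implicit.
Variables (R : realType) (d : nat) (I : interval R) (w : R -> R).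
Variables (phi : {poly R}) (pw pv : nat -> {poly R}).
Hypothesis d_ge3 : (3 <= d)%N.
Hypothesis size_phi : size phi = d.+1.
Hypothesis phi_gt0 : forall x, x \in I -> 0 < phi.[x].
Hypothesis ortho_pw : orthonormal_polys I w pw.
Hypothesis ortho_pv : orthonormal_polys I (fun x => phi.[x] * w x) pv.
Local Notation curve_ring := {poly %/ curve_poly phi}.
Local Notation "<< f , g >>" := (@inner R I w phi f g).
Local Notation y := (Yseq d I w phi pw).
Implicit Types f g : curve_ring.

Let d_ge2 : (2 <= d)%N. Proof. exact: ltnW. Qed.

Lemma size_phiX k : size (phi ^+ k) = (k * d).+1.
Proof.
have phi0 : phi != 0 by rewrite -size_poly_gt0 size_phi.
have := size_exp phi k; rewrite size_phi /= mulnC.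
have : (0 < size (phi ^+ k))%N by rewrite size_poly_gt0 expf_neq0.
by case: (size _) => // n _ /= ->.
Qed.

Lemma size_XphiX a k : size ('X^a * phi ^+ k) = (a + k * d).+1.
Proof.
rewrite size_monicM ?monicXn -?size_poly_gt0 ?size_phiX //.
by rewrite size_polyXn addSn addnS.
Qed.

(** By division with remainder, x^(e mod d) phi^(e div d) has degree e; these are
    the p- or q-parts of the monomials, and they form a basis. *)
Lemma low_degree_vanish (M : {scalar {poly R}}) D (p : {poly R}) :
  (forall e, (e <= D)%N -> M ('X^(e %% d) * phi ^+ (e %/ d)) = 0) ->
  (size p <= D.+1)%N -> M p = 0.
Proof.
move=> MD; pose q e := 'X^(e %% d) * phi ^+ (e %/ d).
have size_q e : size (q e) = e.+1.
  by rewrite size_XphiX addnC -divn_eq.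
case/(orthonormal_expansion size_q) => c ->; rewrite linear_sum big1 // => i _.
by rewrite linearZ /= MD ?mulr0 // -ltnS.
Qed.

Lemma times_functional (L : {scalar {poly R}}) (g : {poly R}) :
  exists M : {scalar {poly R}}, forall p, M p = L (g * p).
Proof.
have linM : linear_for *%R (fun p => L (g * p)).
  by move=> a p q; rewrite mulrDr -scalerAr linearP.
pose mM := GRing.isLinear.Build R {poly R} R *%R _ linM.
pose M : {scalar {poly R}} := HB.pack (fun p : {poly R} => L (g * p)) mM.
by exists M.
Qed.

Section Functional.
Variables (L : {scalar {poly R}}).
Hypothesis LE : forall p,
  L p = \int[@lebesgue_measure R]_(x in [set` I]) (p.[x] * w x).

Let size_pw n : size (pw n) = n.+1.
Proof. by case: ortho_pw => h _; case: (h n). Qed.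

Let size_pv n : size (pv n) = n.+1.
Proof. by case: ortho_pv => h _; case: (h n). Qed.

Let L_pw m n : L (pw m * pw n) = (m == n)%:R.
Proof.
case: ortho_pw => _ <-; rewrite LE; apply: eq_Rintegral => x _.
by rewrite hornerM.
Qed.

Let L_pv m n : L (phi * (pv m * pv n)) = (m == n)%:R.
Proof.
case: ortho_pv => _ <-; rewrite LE; apply: eq_Rintegral => x _.
by rewrite !hornerM; ring.
Qed.

Let innerE f g : <<f, g>> = L (coord_y f 0 * coord_y g 0) *+ 2
                          + L (phi * (coord_y f 1 * coord_y g 1)) *+ 2.
Proof. exact: inner_coord. Qed.

(* The context facts below discharge the hypotheses of the filtration results. *)
Let iC := innerC innerE.
Let iDl := innerDl innerE.
Let iZl := innerZl innerE.
Let ip := inner_parity innerE.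

Let L_ge0 (f : {poly R}) : 0 <= L (f * f). Proof. exact: L_sqr_ge0 L_pw _. Qed.
Let L_eq0 (f : {poly R}) : L (f * f) = 0 -> f = 0. Proof. exact: L_sqr_eq0 L_pw _. Qed.

Let Lphi_ge0 (f : {poly R}) : 0 <= L (phi * (f * f)).
Proof.
have [M ME] := times_functional L phi; rewrite -ME.
by apply: (L_sqr_ge0 size_pv) => m n; rewrite ME L_pv.
Qed.

Let Lphi_eq0 (f : {poly R}) : L (phi * (f * f)) = 0 -> f = 0.
Proof.
have [M ME] := times_functional L phi; rewrite -ME.
by apply: (L_sqr_eq0 size_pv) => m n; rewrite ME L_pv.
Qed.

Let ige0 := inner_ge0 innerE L_ge0 Lphi_ge0.
Let ieq0 := inner_eq0 innerE L_ge0 L_eq0 Lphi_ge0 Lphi_eq0.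

Let coord_yP0 n i : coord_y (P0 phi pw n) i =
  (Num.sqrt 2)^-1%:P * ((i == 0)%:R * pw n).
Proof. by rewrite /P0 !coord_yZ coord_y1 (mulrC (pw n)). Qed.

Let coord_yP1 n i : coord_y (P1 phi pv n) i =
  (Num.sqrt 2)^-1%:P * ((i == 1)%:R * pv n.-1).
Proof. by rewrite /P1 mulr_algr !coord_yZ coord_ycy (mulrC (pv _)). Qed.

Let inner_P0 f n : L (coord_y f 0 * pw n) = 0 -> <<f, P0 phi pw n>> = 0.
Proof.
move=> e; rewrite innerE !coord_yP0 /= mul0r mul1r !mulr0 raddf0 mul0rn addr0.
by rewrite mulrCA mul_polyC linearZ /= e mulr0 mul0rn.
Qed.

Let inner_P1 f n : L (phi * (coord_y f 1 * pv n.-1)) = 0 -> <<f, P1 phi pv n>> = 0.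
Proof.
move=> e; rewrite innerE !coord_yP1 /= mul0r mul1r !mulr0 raddf0 mul0rn add0r.
by rewrite (mulrCA (coord_y f 1)) (mulrCA phi) mul_polyC linearZ /= e mulr0 mul0rn.
Qed.

Let unit_P00 : <<P0 phi pw 0, P0 phi pw 0>> = 1.
Proof.
rewrite innerE !coord_yP0 /= mul0r mul1r !mulr0 raddf0 mul0rn addr0.
rewrite mulrACA -polyCM mul_polyC linearZ /= L_pw mulr1 -invfM -expr2 sqr_sqrtr //.
by rewrite -[LHS]mulr_natr mulVf ?pnatr_eq0.
Qed.

Let filtration a b : (a < d)%N ->
  span (mons_upto d (odd b) (pos d a b)) (y (pos d a b)) /\
  y_upto y (pos d a b) (mon phi a b).
Proof. exact: Yseq_filtration. Qed.

Let lower a b a2 b2 : (a < d)%N -> (a2 < d)%N -> (a2 + b2 < a + b)%N ->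
  <<y (pos d a b), mon phi a2 b2>> = 0.
Proof. exact: Yseq_orthogonal_lower_degree. Qed.

Lemma leq_pos_precedes a b a2 b2 : (a < d)%N -> (a2 < d)%N ->
  (pos d a2 b2 <= pos d a b)%N -> precedes a2 b2 a b || ((a2 == a) && (b2 == b)).
Proof. by move=> ltad lta2d; rewrite leqNgt ltn_pos // /precedes; lia. Qed.

Lemma size_coord_Yseq a b : (a < d)%N ->
  (size (coord_y (y (pos d a b)) (odd b)) <= (x_degree_bound d (a + b) a).+1)%N.
Proof.
move=> ltad; have [sf _] := filtration b ltad.
pose S f := (size (coord_y f (odd b)) <= (x_degree_bound d (a + b) a).+1)%N.
apply: (sf S) => [|_ [a2 [b2 [lta2d le2 odd2 ->]]]]; last first.
  rewrite /S -odd2 (proj1 (coord_y_mon _ _ _)) size_XphiX ltnS.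
  by apply: x_degree_leq => //; apply: leq_pos_precedes.
split=> [|f g Sf Sg|c f Sf]; rewrite /S.
- by rewrite coord_y0 size_poly0.
- by rewrite coord_yD (leq_trans (size_polyD _ _)) // geq_max; apply/andP.
- by rewrite coord_yZ mul_polyC (leq_trans (size_scale_leq _ _)).
Qed.

Lemma coord_Yseq_parity a b : (a < d)%N ->
  coord_y (y (pos d a b)) (~~ odd b) = 0.
Proof. by case/(filtration b) => /mons_upto_pure. Qed.

Lemma coef_P0_low a b i : (a < d)%N ->
  (forall e, (e <= i)%N -> (e %% d + 2 * (e %/ d) < a + b)%N) ->
  <<y (pos d a b), P0 phi pw i>> = 0.
Proof.
move=> ltad low; apply: inner_P0; set f := y _.
have [M ME] := times_functional L (coord_y f 0); rewrite -ME.
apply: (low_degree_vanish (D := i)) => [e lei|]; last by rewrite size_pw.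
have ltmd : (e %% d < d)%N by rewrite ltn_mod ltnW.
have := lower ltad ltmd (low _ lei); rewrite innerE -/f.
have := coord_y_mon phi (e %% d) (2 * (e %/ d)).
rewrite mul2n odd_double doubleK /= => -[-> ->].
by rewrite !mulr0 raddf0 mul0rn addr0 -ME => /eqP; rewrite mulrn_eq0 => /eqP.
Qed.

Lemma coef_P1_low a b i : (a < d)%N ->
  (forall e, (e <= i.-1)%N -> (e %% d + (2 * (e %/ d)).+1 < a + b)%N) ->
  <<y (pos d a b), P1 phi pv i>> = 0.
Proof.
move=> ltad low; apply: inner_P1; set f := y _; rewrite mulrA.
have [M ME] := times_functional L (phi * coord_y f 1); rewrite -ME.
apply: (low_degree_vanish (D := i.-1)) => [e lei|]; last by rewrite size_pv.
have ltmd : (e %% d < d)%N by rewrite ltn_mod ltnW.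
have := lower ltad ltmd (low _ lei); rewrite innerE -/f.
have := coord_y_mon phi (e %% d) (2 * (e %/ d)).+1.
rewrite mul2n /= odd_double /= uphalf_double => -[-> ->].
rewrite !mulr0 raddf0 mul0rn add0r mulrA -ME => /eqP.
by rewrite mulrn_eq0 => /eqP.
Qed.

Lemma coef_P0_high a b i : (a < d)%N -> ~~ odd b ->
  (x_degree_bound d (a + b) a < i)%N -> <<y (pos d a b), P0 phi pw i>> = 0.
Proof.
move=> ltad evenb high; apply: inner_P0.
apply: (orthonormal_low_degree size_pw L_pw).
by have := size_coord_Yseq b ltad; rewrite (negPf evenb) => /leq_trans; apply.
Qed.

Lemma coef_P1_high a b i : (a < d)%N -> odd b ->
  (x_degree_bound d (a + b) a < i.-1)%N -> <<y (pos d a b), P1 phi pv i>> = 0.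
Proof.
move=> ltad oddb high; apply: inner_P1.
have [M ME] := times_functional L phi; rewrite -ME.
apply: (orthonormal_low_degree size_pv) => [m n|]; first by rewrite ME L_pv.
by have := size_coord_Yseq b ltad; rewrite oddb => /leq_trans; apply.
Qed.

Lemma coef_P0_parity a b i : (a < d)%N -> odd b ->
  <<y (pos d a b), P0 phi pw i>> = 0.
Proof.
move=> ltad oddb; apply: inner_P0.
by have := coord_Yseq_parity b ltad; rewrite oddb => ->; rewrite mul0r raddf0.
Qed.

Lemma coef_P1_parity a b i : (a < d)%N -> ~~ odd b ->
  <<y (pos d a b), P1 phi pv i>> = 0.
Proof.
move=> ltad evenb; apply: inner_P1.
have := coord_Yseq_parity b ltad; rewrite evenb => ->.
by rewrite mul0r mulr0 raddf0.
Qed.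

Lemma conn_coefE j n k (a := (block d n - k)%N) : (1 <= k <= block d n)%N ->
  conn_coef d I w phi pw pv j n k = <<y (pos d a (n - a)), Pbasis phi pw pv j>>.
Proof.
move=> hk; rewrite /conn_coef YE //; congr (inner _ _ (y _) _).
have lean : (a <= n)%N by rewrite /a /block; lia.
by rewrite /pos subnKC //; congr ell; rewrite /a; lia.
Qed.

Lemma conn_coef_even j n k (a := (block d n - k)%N) : (0 < n)%N ->
  (1 <= k <= block d n)%N -> ~~ odd (n - a) ->
  ~~ odd j || (2 * x_degree_bound d n a - 1 < j)%N ->
  conn_coef d I w phi pw pv j n k = 0.
Proof.
move=> n0 hk evenb; rewrite conn_coefE // -/a.
have ltad : (a < d)%N by rewrite /a /block; lia.
have en : (a + (n - a))%N = n by rewrite subnKC // /a /block; lia.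
rewrite /Pbasis; case: eqP => [-> _|_].
  by apply: coef_P0_low => // -[|//] _; rewrite mod0n div0n en.
case: ifP => oddj /=; last by move=> _; apply: coef_P1_parity.
by move=> high; apply: coef_P0_high; rewrite // en; lia.
Qed.

Lemma conn_coef_odd j n k (a := (block d n - k)%N) :
  (1 <= k <= block d n)%N -> odd (n - a) ->
  odd j || (2 * x_degree_bound d n a + 2 < j)%N ->
  conn_coef d I w phi pw pv j n k = 0.
Proof.
move=> hk oddb; rewrite conn_coefE // -/a.
have ltad : (a < d)%N by rewrite /a /block; lia.
have en : (a + (n - a))%N = n by rewrite subnKC // /a /block; lia.
rewrite /Pbasis; case: eqP => [-> _|_]; first exact: coef_P0_parity.
case: ifP => oddj /=; first by move=> _; apply: coef_P0_parity.
by move=> high; apply: coef_P1_high; rewrite // en; lia.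
Qed.

(** The first hypothesis concerns the p-parts of degree e up to the degree i of
    P_{i,0}, where j = 2i - 1; the second the q-parts of degree e up to the degree
    i - 1 of the q-part of P_{i,1}, where j = 2i. *)
Lemma conn_coef_low j n k : (1 <= k <= block d n)%N ->
  (forall e, (e.*2 <= j.+1)%N -> (e %% d + 2 * (e %/ d) < n)%N) ->
  (forall e, (e.*2 + 2 <= j)%N -> (e %% d + (2 * (e %/ d)).+1 < n)%N) ->
  conn_coef d I w phi pw pv j n k = 0.
Proof.
move=> hk low0 low1; rewrite conn_coefE //; set a := (_ - k)%N.
have ltad : (a < d)%N by rewrite /a /block; lia.
have en : (a + (n - a))%N = n by rewrite subnKC // /a /block; lia.
rewrite /Pbasis; case: eqP => [_|j0].
  by apply: coef_P0_low => // -[|//] _; rewrite en; apply: low0.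
case: ifP => oddj.
  by apply: coef_P0_low => // e le; rewrite en; apply: low0; lia.
by apply: coef_P1_low => // e le; rewrite en; apply: low1; lia.
Qed.

(** In the next two lemmas a is the exponent of x in the monomial of Y_{n+1,k};
    the parity of n + 1 - a then decides whether Y is a pure p- or q-part. *)
Lemma conn_coef_high_n_even n j k (a := (block d (n + 1) - k)%N)
    (C := conn_coef d I w phi pw pv j (n + 1) k) :
  ~~ odd n -> (1 <= k <= block d (n + 1))%N ->
  [/\ a = 0%N -> odd j || (n * d + 2 < j)%N -> C = 0,
      a = 1%N -> ~~ odd j || (n * d + 1 < j)%N -> C = 0,
      a = 2%N -> odd j || ((n - 2) * d + 6 < j)%N -> C = 0,
      (2 < a)%N -> odd a -> ~~ odd j || (n * d - 1 < j)%N -> C = 0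
    & (2 < a)%N -> ~~ odd a -> odd j || ((n - 2) * d + 4 < j)%N -> C = 0].
Proof.
move=> evenn hk; have lean : (a <= n + 1)%N by rewrite /a /block; lia.
have even_case B : (x_degree_bound d (n + 1) a).*2 = B -> ~~ odd (n + 1 - a) ->
    ~~ odd j || (B - 1 < j)%N -> C = 0.
  by rewrite -mul2n => <-; apply: conn_coef_even => //; rewrite addn1.
have odd_case B : (x_degree_bound d (n + 1) a).*2 = B -> odd (n + 1 - a) ->
    odd j || (B + 2 < j)%N -> C = 0.
  by rewrite -mul2n => <-; apply: conn_coef_odd.
have e0 : ((n + 1)./2.*2 = n)%N by lia.
have e1 : ((n + 1 - 1)./2.*2 = n)%N by lia.
have e2 : ((n + 1 - 2)./2.*2 = n - 2)%N by lia.
split=> [a0|a1|a2|gt2 odda|gt2 evena] hj.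
- apply: (odd_case (n * d)%N); [|lia|lia].
  by rewrite double_x_degree_bound a0 subn0 e0.
- apply: (even_case (2 + n * d)%N); [|lia|lia].
  by rewrite double_x_degree_bound a1 e1.
- apply: (odd_case (4 + (n - 2) * d)%N); [|lia|lia].
  by rewrite double_x_degree_bound a2 e2.
- apply: (even_case (n * d)%N) => //; last by lia.
  by rewrite double_x_degree_bound leqNgt gt2 odda e1.
- apply: (odd_case (2 + (n - 2) * d)%N); [|lia|lia].
  by rewrite double_x_degree_bound leqNgt gt2 (negPf evena) e2.
Qed.

Lemma conn_coef_high_n_odd n j k (a := (block d (n + 1) - k)%N)
    (C := conn_coef d I w phi pw pv j (n + 1) k) :
  odd n -> (1 <= k <= block d (n + 1))%N ->
  [/\ a = 0%N -> ~~ odd j || ((n + 1) * d - 1 < j)%N -> C = 0,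
      a = 1%N -> odd j || (4 + (n - 1) * d < j)%N -> C = 0,
      a = 2%N -> ~~ odd j || (3 + (n - 1) * d < j)%N -> C = 0,
      (2 < a)%N -> odd a -> odd j || (2 + (n - 1) * d < j)%N -> C = 0
    & (2 < a)%N -> ~~ odd a -> ~~ odd j || (1 + (n - 1) * d < j)%N -> C = 0].
Proof.
move=> oddn hk; have lean : (a <= n + 1)%N by rewrite /a /block; lia.
have even_case B : (x_degree_bound d (n + 1) a).*2 = B -> ~~ odd (n + 1 - a) ->
    ~~ odd j || (B - 1 < j)%N -> C = 0.
  by rewrite -mul2n => <-; apply: conn_coef_even => //; rewrite addn1.
have odd_case B : (x_degree_bound d (n + 1) a).*2 = B -> odd (n + 1 - a) ->
    odd j || (B + 2 < j)%N -> C = 0.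
  by rewrite -mul2n => <-; apply: conn_coef_odd.
have e0 : ((n + 1)./2.*2 = n + 1)%N by lia.
have e1 : ((n + 1 - 1)./2.*2 = n - 1)%N by lia.
have e2 : ((n + 1 - 2)./2.*2 = n - 1)%N by lia.
split=> [a0|a1|a2|gt2 odda|gt2 evena] hj.
- apply: (even_case ((n + 1) * d)%N); [|lia|lia].
  by rewrite double_x_degree_bound a0 subn0 e0.
- apply: (odd_case (2 + (n - 1) * d)%N); [|lia|lia].
  by rewrite double_x_degree_bound a1 e1.
- apply: (even_case (4 + (n - 1) * d)%N); [|lia|lia].
  by rewrite double_x_degree_bound a2 e2.
- apply: (odd_case ((n - 1) * d)%N); [|lia|lia].
  by rewrite double_x_degree_bound leqNgt gt2 odda e1.
- apply: (even_case (2 + (n - 1) * d)%N); [|lia|lia].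
  by rewrite double_x_degree_bound leqNgt gt2 (negPf evena) e2.
Qed.

Lemma conn_coef_low_initial n j k : (n <= d - 2)%N ->
  (1 <= k <= block d (n + 1))%N -> (j < 2 * n + 1)%N ->
  conn_coef d I w phi pw pv j (n + 1) k = 0.
Proof.
move=> hn hk hj.
by apply: conn_coef_low => // e he; rewrite modn_small ?divn_small //; lia.
Qed.

(** The q-parts decide: degree (c + 1) d - 1, at j = 2 (c + 1) d, is the first
    whose monomial, x^(d-1) y^(2c+1), has total degree n + 1. *)
Lemma conn_coef_low_even_gap n c j k : (n + 1 = d + 2 * c)%N ->
  (1 <= k <= block d (n + 1))%N -> (j < 2 * d + 2 * (c * d))%N ->
  conn_coef d I w phi pw pv j (n + 1) k = 0.
Proof.
move=> nE hk hj; have ltmd e : (e %% d < d)%N by rewrite ltn_mod ltnW.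
apply: conn_coef_low => // e he; have := ltmd e.
  have le : (e <= c.+1 * d + 0)%N by rewrite mulSn; lia.
  by have := leq_divmod d_ge3 (ltnW d_ge2) le; lia.
have le : (e <= c * d + (d - 2))%N by lia.
have lt : (d - 2 < d)%N by lia.
by have := leq_divmod d_ge3 lt le; lia.
Qed.

(** The p-parts decide: degree (c + 2) d - 1, at j = 2 (c + 2) d - 3, is the first
    whose monomial, x^(d-1) y^(2c+2), has total degree n + 1. *)
Lemma conn_coef_low_odd_gap n c j k : (n = d + 2 * c)%N ->
  (1 <= k <= block d (n + 1))%N -> (j < 2 * d - 3 + 2 * (c.+1 * d))%N ->
  conn_coef d I w phi pw pv j (n + 1) k = 0.
Proof.
move=> nE hk hj; have ltmd e : (e %% d < d)%N by rewrite ltn_mod ltnW.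
apply: conn_coef_low => // e he; have := ltmd e.
  have le : (e <= c.+1 * d + (d - 2))%N by lia.
  have lt : (d - 2 < d)%N by lia.
  by have := leq_divmod d_ge3 lt le; lia.
have le : (e <= c.+1 * d + (d - 3))%N by lia.
have lt : (d - 3 < d)%N by lia.
by have := leq_divmod d_ge3 lt le; lia.
Qed.

End Functional.
End ConnectionCoefficients.
Theorem propositionB1 (R : realType) (d : nat) (I : interval R) (w : R -> R)
    (phi : {poly R}) (pw pv : nat -> {poly R}) (n : nat) :
  (4 <= d)%N ->
  admissible_interval I ->
  is_weight I w ->
  size phi = d.+1 ->
  (forall x, x \in I -> 0 < phi.[x]) ->
  orthonormal_polys I w pw ->
  orthonormal_polys I (fun x => phi.[x] * w x) pv ->
  let C := fun j k : nat => conn_coef d I w phi pw pv j (n + 1) k in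
  (* (A) *)
  ((n <= d - 2)%N ->
    [/\ vanishes C (fun j => j < 2 * n + 1)%N (fun k => k <= n + 2)%N,
        (* (A1) *)
        ~~ odd n ->
        [/\ vanishes C (fun j => ~~ odd j || (n * d - 1 < j)%N)
              (fun k => odd k && (k <= n - 1)%N),
            vanishes C (fun j => odd j || ((n - 2) * d + 4 < j)%N)
              (fun k => ~~ odd k && (k <= n - 2)%N),
            vanishes C (fun j => odd j || ((n - 2) * d + 6 < j)%N)
              (fun k => k == n),
            vanishes C (fun j => ~~ odd j || (n * d + 1 < j)%N)
              (fun k => k == (n + 1)%N)
          & vanishes C (fun j => odd j || (n * d + 2 < j)%N)
              (fun k => k == (n + 2)%N)]
      & (* (A2) *)
        odd n ->
        [/\ vanishes C (fun j => ~~ odd j || (1 + (n - 1) * d < j)%N)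
              (fun k => odd k && (k <= n - 2)%N),
            vanishes C (fun j => odd j || (2 + (n - 1) * d < j)%N)
              (fun k => ~~ odd k && (k <= n - 1)%N),
            vanishes C (fun j => ~~ odd j || (3 + (n - 1) * d < j)%N)
              (fun k => k == n),
            vanishes C (fun j => odd j || (4 + (n - 1) * d < j)%N)
              (fun k => k == (n + 1)%N)
          & vanishes C (fun j => ~~ odd j || ((n + 1) * d - 1 < j)%N)
              (fun k => k == (n + 2)%N)]])
  /\
  (* (B) *)
  ((d - 1 <= n)%N ->
    [/\ ((n + 1 - d) %% 2 = 0)%N ->
          vanishes C (fun j => j < 2 * d + d * (n + 1 - d))%N
            (fun k => k <= d)%N,
        ((n + 1 - d) %% 2 = 1)%N ->
          vanishes C (fun j => j < 2 * d - 3 + d * (n + 2 - d))%N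
            (fun k => k <= d)%N
      & [/\ (* (B1) *)
            ~~ odd d -> ((n + 1 - d) %% 2 = 0)%N ->
            [/\ vanishes C (fun j => odd j || (2 + (n - 1) * d < j)%N)
                  (fun k => odd k && (k <= d - 3)%N),
                vanishes C (fun j => ~~ odd j || (1 + (n - 1) * d < j)%N)
                  (fun k => ~~ odd k && (k <= d - 4)%N),
                vanishes C (fun j => ~~ odd j || (3 + (n - 1) * d < j)%N)
                  (fun k => k == (d - 2)%N),
                vanishes C (fun j => odd j || (4 + (n - 1) * d < j)%N)
                  (fun k => k == (d - 1)%N)
              & vanishes C (fun j => ~~ odd j || ((n + 1) * d - 1 < j)%N)
                  (fun k => k == d)],
            (* (B2) *)
            ~~ odd d -> ((n + 1 - d) %% 2 = 1)%N ->
            [/\ vanishes C (fun j => ~~ odd j || (n * d - 1 < j)%N)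
                  (fun k => odd k && (k <= d - 3)%N),
                vanishes C (fun j => odd j || ((n - 2) * d + 4 < j)%N)
                  (fun k => ~~ odd k && (k <= d - 4)%N),
                vanishes C (fun j => odd j || ((n - 2) * d + 6 < j)%N)
                  (fun k => k == (d - 2)%N),
                vanishes C (fun j => ~~ odd j || (n * d + 1 < j)%N)
                  (fun k => k == (d - 1)%N)
              & vanishes C (fun j => odd j || (n * d + 2 < j)%N)
                  (fun k => k == d)],
            (* (B3) *)
            odd d -> ((n + 1 - d) %% 2 = 0)%N ->
            [/\ vanishes C (fun j => odd j || ((n - 2) * d + 4 < j)%N)
                  (fun k => odd k && (k <= d - 4)%N),
                vanishes C (fun j => ~~ odd j || (n * d - 1 < j)%N)
                  (fun k => ~~ odd k && (k <= d - 3)%N),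
                vanishes C (fun j => odd j || ((n - 2) * d + 6 < j)%N)
                  (fun k => k == (d - 2)%N),
                vanishes C (fun j => ~~ odd j || (n * d + 1 < j)%N)
                  (fun k => k == (d - 1)%N)
              & vanishes C (fun j => odd j || (n * d + 2 < j)%N)
                  (fun k => k == d)]
          & (* (B4) *)
            odd d -> ((n + 1 - d) %% 2 = 1)%N ->
            [/\ vanishes C (fun j => ~~ odd j || (1 + (n - 1) * d < j)%N)
                  (fun k => odd k && (k <= d - 4)%N),
                vanishes C (fun j => odd j || (2 + (n - 1) * d < j)%N)
                  (fun k => ~~ odd k && (k <= d - 3)%N),
                vanishes C (fun j => ~~ odd j || (3 + (n - 1) * d < j)%N)
                  (fun k => k == (d - 2)%N),
                vanishes C (fun j => odd j || (4 + (n - 1) * d < j)%N)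
                  (fun k => k == (d - 1)%N)
              & vanishes C (fun j => ~~ odd j || ((n + 1) * d - 1 < j)%N)
                  (fun k => k == d)]]]).

Proof.
move=> hd _ [_ _ _ moments_fin] size_phi phi_gt0 ortho_pw ortho_pv C.
have [L LE] := moment_functional moments_fin.
have d_ge3 : (3 <= d)%N := ltnW hd.
have high_even j k := conn_coef_high_n_even d_ge3 size_phi phi_gt0 ortho_pw
  ortho_pv LE j (n := n) (k := k).
have high_odd j k := conn_coef_high_n_odd d_ge3 size_phi phi_gt0 ortho_pw
  ortho_pv LE j (n := n) (k := k).
(* The lists of vanishing coefficients go by a = block d (n + 1) - k, the exponent
   of x: first the two parities of a > 2, then a = 2, 1 and 0. *)
split=> hn.
  have blockE : block d (n + 1) = (n + 2)%N by rewrite /block; lia.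
  rewrite blockE in high_even high_odd.
  split=> [j k /= hj k1 /= hk|evenn|oddn].
  - apply: (conn_coef_low_initial d_ge3 size_phi phi_gt0 ortho_pw ortho_pv LE) => //.
    by rewrite blockE k1.
  - split=> j k /= hj k1 /= hk.
    + by case: (high_even j k evenn) => [|_ _ _ h _]; [lia | apply: h => //; lia].
    + by case: (high_even j k evenn) => [|_ _ _ _ h]; [lia | apply: h => //; lia].
    + by case: (high_even j k evenn) => [|_ _ h _ _]; [lia | apply: h => //; lia].
    + by case: (high_even j k evenn) => [|_ h _ _ _]; [lia | apply: h => //; lia].
    + by case: (high_even j k evenn) => [|h _ _ _ _]; [lia | apply: h => //; lia].
  - split=> j k /= hj k1 /= hk.
    + by case: (high_odd j k oddn) => [|_ _ _ _ h]; [lia | apply: h => //; lia].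
    + by case: (high_odd j k oddn) => [|_ _ _ h _]; [lia | apply: h => //; lia].
    + by case: (high_odd j k oddn) => [|_ _ h _ _]; [lia | apply: h => //; lia].
    + by case: (high_odd j k oddn) => [|_ h _ _ _]; [lia | apply: h => //; lia].
    + by case: (high_odd j k oddn) => [|h _ _ _ _]; [lia | apply: h => //; lia].
have blockE : block d (n + 1) = d by rewrite /block; lia.
rewrite blockE in high_even high_odd.
split=> [gap j k /= hj k1 /= hk|gap j k /= hj k1 /= hk|].
- have [c nE] : exists c, (n + 1 = d + 2 * c)%N by exists ((n + 1 - d) %/ 2)%N; lia.
  apply: (conn_coef_low_even_gap d_ge3 size_phi phi_gt0 ortho_pw ortho_pv LE nE).
    by rewrite blockE k1.
  by move: hj; rewrite (_ : n + 1 - d = 2 * c)%N; lia.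
- have [c nE] : exists c, (n = d + 2 * c)%N by exists ((n + 1 - d) %/ 2)%N; lia.
  apply: (conn_coef_low_odd_gap d_ge3 size_phi phi_gt0 ortho_pw ortho_pv LE nE).
    by rewrite blockE k1.
  by move: hj; rewrite (_ : n + 2 - d = 2 * c.+1)%N; lia.
- split=> pd gap.
  - have oddn : odd n by lia.
    split=> j k /= hj k1 /= hk.
    + by case: (high_odd j k oddn) => [|_ _ _ h _]; [lia | apply: h => //; lia].
    + by case: (high_odd j k oddn) => [|_ _ _ _ h]; [lia | apply: h => //; lia].
    + by case: (high_odd j k oddn) => [|_ _ h _ _]; [lia | apply: h => //; lia].
    + by case: (high_odd j k oddn) => [|_ h _ _ _]; [lia | apply: h => //; lia].
    + by case: (high_odd j k oddn) => [|h _ _ _ _]; [lia | apply: h => //; lia].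
  - have evenn : ~~ odd n by lia.
    split=> j k /= hj k1 /= hk.
    + by case: (high_even j k evenn) => [|_ _ _ h _]; [lia | apply: h => //; lia].
    + by case: (high_even j k evenn) => [|_ _ _ _ h]; [lia | apply: h => //; lia].
    + by case: (high_even j k evenn) => [|_ _ h _ _]; [lia | apply: h => //; lia].
    + by case: (high_even j k evenn) => [|_ h _ _ _]; [lia | apply: h => //; lia].
    + by case: (high_even j k evenn) => [|h _ _ _ _]; [lia | apply: h => //; lia].
  - have evenn : ~~ odd n by lia.
    split=> j k /= hj k1 /= hk.
    + by case: (high_even j k evenn) => [|_ _ _ _ h]; [lia | apply: h => //; lia].
    + by case: (high_even j k evenn) => [|_ _ _ h _]; [lia | apply: h => //; lia].
    + by case: (high_even j k evenn) => [|_ _ h _ _]; [lia | apply: h => //; lia].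
    + by case: (high_even j k evenn) => [|_ h _ _ _]; [lia | apply: h => //; lia].
    + by case: (high_even j k evenn) => [|h _ _ _ _]; [lia | apply: h => //; lia].
  - have oddn : odd n by lia.
    split=> j k /= hj k1 /= hk.
    + by case: (high_odd j k oddn) => [|_ _ _ _ h]; [lia | apply: h => //; lia].
    + by case: (high_odd j k oddn) => [|_ _ _ h _]; [lia | apply: h => //; lia].
    + by case: (high_odd j k oddn) => [|_ _ h _ _]; [lia | apply: h => //; lia].
    + by case: (high_odd j k oddn) => [|_ h _ _ _]; [lia | apply: h => //; lia].
    + by case: (high_odd j k oddn) => [|h _ _ _ _]; [lia | apply: h => //; lia].
Qed.
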